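(* For every $n\geq 2$ and every $r\in[n]$, $$\sum_{T\in \mathcal P_{n}^{(r)}}t^{\mathrm{eld}(T)}\prod_{i=1}^{n}x_i^{\mathrm{young}_T(i)}=x_r\prod_{k=1}^{n-2}(x_1+\cdots+x_{n}+kt).$$
   Context: All trees are rooted trees whose vertices are labeled by distinct positive integers. A vertex $j$ is a descendant of $i$ if the path from the root to $j$ passes through $i$ (every vertex is a descendant of itself); $\beta_T(i)$ is the smallest descendant of $i$. A child of $i$ is a descendant joined to $i$ by an edge; children of the same vertex are brothers. A plane tree is a rooted tree in which the children of each vertex are linearly ordered (left to right). In a plane tree $T$, a vertex $j$ is elder if it has a brother $k$ to its right with $\beta_T(k)<\beta_T(j)$. $\mathrm{eld}_T(v)$ is the number of elder children of $v$, $\mathrm{eld}(T)$ the total number of elder vertices, $\deg_T(v)$ the number of children of $v$, and $\mathrm{young}_T(v)=\deg_T(v)-\mathrm{eld}_T(v)$. $\mathcal P_n^{(r)}$ is the set of plane trees on $[n]=\{1,\dots,n\}$ with root $r$. The empty product equals $1$. *)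

(* Defs.v *)
From mathcomp Require Import all_boot all_order all_algebra.
Set Implicit Arguments. Unset Strict Implicit. Unset Printing Implicit Defensive.
Import GRing.Theory.

(* Vertex labels: the vertex i : 'I_n stands for the label i+1 of [n].
   The relabelling is order preserving, so smallest descendants / elder
   vertices are unaffected.

   A plane tree on [n] with root r is encoded by a pair (par, pos):
   - par v is the parent of v (par r = r for the root);
   - pos v is the position (0-based, left to right) of v among its brothers
     (pos r = 0 for the root).
   This encoding is a bijection with plane trees on [n] rooted at r. *)

Section PlaneTrees.
Variable n : nat.

Definition ptree := ({ffun 'I_n -> 'I_n} * {ffun 'I_n -> 'I_n})%type.

Definition tpar (T : ptree) : 'I_n -> 'I_n := T.1.
Definition tpos (T : ptree) (v : 'I_n) : nat := T.2 v.

Definition children (r : 'I_n) (T : ptree) (u : 'I_n) : {set 'I_n} :=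
  [set v | (v != r) && (tpar T v == u)].

Definition deg (r : 'I_n) (T : ptree) (u : 'I_n) : nat := #|children r T u|.

Definition is_plane_tree (r : 'I_n) (T : ptree) : bool :=
  [&& tpar T r == r, tpos T r == 0%N,
      (* every vertex reaches the root by following parents: acyclic, connected *)
      [forall v, iter n (tpar T) v == r] &
      (* positions of the children of u are exactly 0, ..., deg u - 1 *)
      [forall u, [forall v in children r T u, tpos T v < deg r T u] &&
                 [forall v in children r T u, forall w in children r T u,
                    (tpos T v == tpos T w) ==> (v == w)]]].

Definition desc (T : ptree) (i j : 'I_n) : bool :=
  [exists k : 'I_n.+1, iter k (tpar T) j == i].

Definition beta (T : ptree) (i : 'I_n) : nat :=
  \big[minn/n]_(j | desc T i j) (j : nat).

Definition elder (r : 'I_n) (T : ptree) (j : 'I_n) : bool :=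
  (j != r) &&
  [exists k in children r T (tpar T j),
     (tpos T j < tpos T k) && (beta T k < beta T j)].

Definition eldv (r : 'I_n) (T : ptree) (v : 'I_n) : nat :=
  #|[set j in children r T v | elder r T j]|.

Definition eld (r : 'I_n) (T : ptree) : nat := #|[set j | elder r T j]|.

Definition young (r : 'I_n) (T : ptree) (v : 'I_n) : nat :=
  deg r T v - eldv r T v.

End PlaneTrees.

(* Main.v *)
Require Import Defs.
From mathcomp Require Import all_boot all_order all_algebra.
From mathcomp Require Import ring zify.
Import GRing.Theory.
Local Open Scope ring_scope.
Set Implicit Arguments. Unset Strict Implicit. Unset Printing Implicit Defensive.

(** Write [rise t x d = x (x + t) ... (x + (d - 1) t)]. For a fixed parent
    function the smallest descendants are fixed, and inserting the children of
    [u] by increasing smallest descendant, the k-th one (from 0) can be put last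
    (young, weight [x u]) or before one of its k predecessors (elder, weight
    [t]). So the orderings of the [d] children of [u] contribute
    [rise t (x u) d], and the sum becomes one over rooted labelled trees of
    [\prod_u rise t (x u) (deg u)].
    More generally, sum this weight over the forests with root set [S] and
    non-root vertices [U]. Removing a root [s] turns the set [A] of its children
    into roots; by induction and the Chu-Vandermonde identity for [rise], the sum
    is [rise t X m - x_U * rise t (X + t) (m - 1)], where [m] is the size of [U],
    [x_U] is the sum of [x] over [U] and [X] its sum over [S] and [U]. For
    [S = {r}] this is [x r * rise t (X + t) (n - 2)]. *)

(** * Reindexing of big operators, rising factorials and Chu-Vandermonde *)

Lemma big_bij (T : Type) (idx : T) (op : Monoid.com_law idx) (I J : finType)
    (P : pred I) (Q : pred J) (h : I -> J) (h' : J -> I) (F : I -> T) :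
  (forall i, P i -> Q (h i) /\ h' (h i) = i) ->
  (forall j, Q j -> P (h' j) /\ h (h' j) = j) ->
  \big[op/idx]_(i | P i) F i = \big[op/idx]_(j | Q j) F (h' j).
Proof.
move=> hP hQ; rewrite (reindex_onto h' h); last by move=> i /hP[].
apply: eq_bigl => j; apply/andP/idP => [[Pj /eqP <-]|/hQ[-> ->] //].
by case: (hP _ Pj).
Qed.

Definition rise (R : pzRingType) (t x : R) (n : nat) : R :=
  \prod_(i < n) (x + i%:R * t).

Lemma rise0 (R : pzRingType) (t x : R) : rise t x 0 = 1.
Proof. exact: big_ord0. Qed.

Lemma riseS (R : pzRingType) (t x : R) n :
  rise t x n.+1 = rise t x n * (x + n%:R * t).
Proof. exact: big_ord_recr. Qed.

Lemma riseSl (R : pzRingType) (t x : R) n :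
  rise t x n.+1 = x * rise t (x + t) n.
Proof.
rewrite /rise big_ord_recl mul0r addr0; congr (_ * _).
by apply: eq_bigr => i _; rewrite lift0 -natr1 mulrDl mul1r addrA addrAC.
Qed.

Lemma big_subsetD1 (T : Type) (idx : T) (op : Monoid.com_law idx) (V : finType)
    (D : {set V}) (v : V) (F : {set V} -> T) : v \in D ->
  \big[op/idx]_(A : {set V} | A \subset D) F A =
  op (\big[op/idx]_(A : {set V} | A \subset D :\ v) F (v |: A))
     (\big[op/idx]_(A : {set V} | A \subset D :\ v) F A).
Proof.
move=> vD; rewrite (bigID (fun A : {set V} => v \in A)) /=; congr (op _ _).
  apply: (@big_bij _ _ _ _ _ _ _ (fun A => A :\ v)) => A.
    by case/andP=> AD vA; rewrite setSD // setD1K.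
  rewrite subsetD1 => /andP[AD vA]; rewrite setU11 subUset sub1set vD AD.
  by rewrite setU1K.
by apply: eq_bigl => A; rewrite subsetD1.
Qed.

(* Chu-Vandermonde, with the binomial coefficients replaced by a sum over
   subsets. *)
Lemma rise_subsets (R : comPzRingType) (t y z : R) (V : finType) (D : {set V}) :
  \sum_(A : {set V} | A \subset D) rise t y #|A| * rise t z #|D :\: A| =
  rise t (y + z) #|D|.
Proof.
elim: {D}_.+1 {-2}D (ltnSn #|D|) => // m IH D ltDm.
have [->|[v vD]] := set_0Vmem D.
  rewrite (big_pred1 set0) ?setD0 ?cards0 ?rise0 ?mulr1 // => A.
  exact: subset0.
have cD : #|D| = #|D :\ v|.+1 by rewrite (cardsD1 v) vD.
(* The element [v] joins [A] or its complement. The two new factors, [y] plus [#|A|] times [t] and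
   [z] plus [#|D :\ v :\: A|] times [t], add up to the last factor of the right-hand [rise]. *)
rewrite (big_subsetD1 _ _ vD) /= -big_split /= cD riseS -IH; last by lia.
rewrite mulr_suml; apply: eq_bigr => A; rewrite subsetD1 => /andP[AD vA].
rewrite setDDl cardsU1 vA add1n.
have -> : #|D :\: A| = #|D :\ v :\: A|.+1.
  by rewrite (cardsD1 v) in_setD vA vD setDDl setDDl setUC.
rewrite setDDl !riseS.
have -> : #|D :\ v| = (#|A| + #|D :\: (v |: A)|)%N.
  rewrite -(cardsID A (D :\ v)) setDDl; congr (#|pred_of_set _| + _)%N.
  apply/setP=> w; rewrite !inE; case wA: (w \in A); rewrite ?andbF // !andbT.
  by rewrite (subsetP AD) // andbT; apply: contraNneq vA => <-.
by rewrite natrD; ring.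
Qed.

(** * Weighted enumeration of rooted forests *)

(* Roots [S], other vertices [U], parent function [f]; outside [U] the value is
   fixed to make [f] unique. Acyclicity is the absence of a nonempty subset of
   [U] stable under [f]. *)
Definition forest (V : finType) (S U : {set V}) (f : {ffun V -> V}) : bool :=
  [forall v, if v \in U then f v \in S :|: U else f v == v] &&
  [forall W : {set V},
     (W \subset U) && [forall w in W, f w \in W] ==> (W == set0)].

Lemma forestP (V : finType) (S U : {set V}) (f : {ffun V -> V}) :
  reflect [/\ forall v, v \in U -> f v \in S :|: U,
              forall v, v \notin U -> f v = v &
              forall W : {set V}, W \subset U ->
                (forall w, w \in W -> f w \in W) -> W = set0]
          (forest S U f).
Proof.
apply: (iffP andP) => [[/forallP fU /forallP fW]|[fU fnU fW]].
  split=> [v vU|v /negPf vU|W WU Wf].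
  - by have := fU v; rewrite vU.
  - by have := fU v; rewrite vU => /eqP.
  have /implyP := fW W; rewrite WU => hW; apply/eqP/hW.
  exact/forall_inP.
split; apply/forallP.
  by move=> v; case: ifPn => vU; [exact: fU | rewrite fnU].
by move=> W; apply/implyP=> /andP[WU /forall_inP Wf]; apply/eqP/fW.
Qed.

(** Restricting to [U] keeps a root, which [f] fixes, out of its own set of children. *)
Definition fiber (V : finType) (U : {set V}) (f : V -> V) (u : V) : {set V} :=
  [set v in U | f v == u].

(* For nonempty [U] the right-hand side is
   [(\sum_(u in S) x u) * rise t (X + t) #|U|.-1] with [X] the sum over
   [S :|: U]; the difference form is also right for empty [U] and is the one that
   the induction reproduces term by term. *)
Lemma sum_forest (R : comPzRingType) (t : R) (V : finType) (x : V -> R)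
    (S U : {set V}) :
  [disjoint S & U] ->
  \sum_(f | forest S U f) \prod_u rise t (x u) #|fiber U f u| =
  rise t (\sum_(u in S :|: U) x u) #|U| -
  (\sum_(u in U) x u) * rise t (\sum_(u in S :|: U) x u + t) #|U|.-1.
Proof.
elim: {S U}_.+1 {-2}S {-2}U (ltnSn #|S :|: U|) => // m IH S U ltm dSU.
(* If [S] is empty, a nonempty [U] is itself stable, so there is no forest, and [riseSl] makes the
   right-hand side vanish. If [U] is empty too, only the identity remains. *)
have [S0|[s sS]] := set_0Vmem S.
  rewrite S0 set0U; have [->|[v vU]] := set_0Vmem U.
    rewrite (big_pred1 (finfun id)) => [|f /=].
      rewrite big1 ?cards0 ?rise0 ?big_set0 ?mul0r ?subr0 // => u _.
      by rewrite (_ : fiber _ _ _ = set0) ?cards0 ?rise0 //; apply/setP=> w; rewrite !inE.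
    apply/forestP/eqP => [[_ f0 _]|->].
      by apply/ffunP=> w; rewrite ffunE f0 ?inE.
    split=> [w|w _|W]; rewrite ?inE ?ffunE //.
    by rewrite subset0 => /eqP.
  rewrite big_pred0 => [|f].
    by rewrite (cardsD1 v) vU riseSl subrr.
  apply/negP=> /forestP[fU _ /(_ U)]; rewrite subxx => U0.
  have: v \in set0 by rewrite -U0 // => w /fU; rewrite set0U.
  by rewrite inE.
have sU : s \notin U by rewrite (disjointFr dSU sS).
(* The root [s] is deleted and the set [A] of its children becomes part of the roots: [cut] turns
   them into fixed points, [glue] attaches them to [s] again. *)
pose S' (A : {set V}) := (S :\ s) :|: A.
pose glue (Ah : {set V} * {ffun V -> V}) : {ffun V -> V} :=
  [ffun v => if v \in Ah.1 then s else Ah.2 v].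
pose cut (f : {ffun V -> V}) : {set V} * {ffun V -> V} :=
  (fiber U f s, [ffun v => if v \in fiber U f s then v else f v]).
pose Q (Ah : {set V} * {ffun V -> V}) :=
  (Ah.1 \subset U) && forest (S' Ah.1) (U :\: Ah.1) Ah.2.
have SU' (A : {set V}) : A \subset U -> S' A :|: (U :\: A) = (S :|: U) :\ s.
  move=> AU; apply/setP=> w; rewrite !inE.
  have sA : s \notin A by apply: contra sU; apply: subsetP.
  have [->|_] := eqVneq w s; first by rewrite (negPf sU) (negPf sA).
  by case: (boolP (w \in A)) => [/(subsetP AU) ->|] //=; rewrite ?orbT ?orbF.
have glueP Ah : Q Ah -> forest S U (glue Ah) /\ cut (glue Ah) = Ah.
  case: Ah => A h /andP[/= AU /forestP[hU hnU hW]].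
  have hs v : v \in U -> v \notin A -> h v != s /\ h v \in S :|: U.
    move=> vU vA; have := hU v; rewrite SU' // inE vA vU => /(_ isT).
    by rewrite !inE => /andP[].
  have fib : fiber U (glue (A, h)) s = A.
    apply/setP=> v; rewrite !inE ffunE /=.
    case: ifPn => [vA|vA]; first by rewrite (subsetP AU) ?eqxx.
    by case vU: (v \in U) => //=; case: (hs v vU vA) => /negPf.
  split.
    apply/forestP; split=> [v vU|v vU|W WU Wf].
    - rewrite ffunE /=; case: ifPn => vA; first by rewrite inE sS.
      by case: (hs v vU vA).
    - have vA : v \notin A by apply: contra vU => /(subsetP AU).
      by rewrite ffunE /= (negPf vA) hnU // inE vA vU.
    (* Vertices of [A] are sent to [s], which is outside [U], so a stable [W] avoids [A] and is
       already stable under [h]. *)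
    have WA w : w \in W -> w \notin A.
      move=> wW; apply: contra sU => wA.
      by have /(subsetP WU) := Wf w wW; rewrite ffunE /= wA.
    apply: hW => [|w wW].
      by apply/subsetP=> w wW; rewrite inE WA //= (subsetP WU).
    by have := Wf w wW; rewrite ffunE /= (negPf (WA _ wW)).
  rewrite /cut fib; congr (_, _); apply/ffunP=> v; rewrite !ffunE /=.
  by case: ifP => [vA|-> //]; rewrite hnU ?inE ?vA.
have cutP f : forest S U f -> Q (cut f) /\ glue (cut f) = f.
  case/forestP=> fU fnU fW.
  have AU : fiber U f s \subset U by apply/subsetP=> v; rewrite inE => /andP[].
  split; last first.
    by apply/ffunP=> v; rewrite !ffunE /=; case: ifP => [|-> //]; rewrite inE => /andP[_ /eqP].
  rewrite /Q /= AU; apply/forestP; split=> [v|v|W WU Wf].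
  - rewrite SU' // in_setD => /andP[vA vU]; rewrite ffunE (negPf vA).
    rewrite in_setD1 fU // andbT; apply: contra vA => fvs.
    by rewrite inE vU.
  - rewrite in_setD negb_and negbK ffunE; case: ifP => //= _; exact: fnU.
  apply: fW => [|w wW].
    by apply: subset_trans WU _; apply: subsetDl.
  have := Wf w wW; rewrite ffunE; case: ifP => // wA _.
  by have := subsetP WU w wW; rewrite inE wA.
rewrite (@big_bij _ _ _ _ _ (forest S U) Q cut glue _ cutP glueP) /=.
set y := x s; set Y := \sum_(u in (S :|: U) :\ s) x u.
have XE : \sum_(u in S :|: U) x u = y + Y by rewrite (big_setD1 s) // inE sS.
rewrite XE.
(* By [SU'] the sum of [x] over the smaller forest is [Y] whatever [A] is, so the induction
   hypothesis yields [rise t Y] and [rise t (Y + t)]; the root [s] itself contributes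
   [rise t y #|A|]. *)
transitivity (\sum_(A : {set V} | A \subset U)
   (rise t y #|A| * rise t Y #|U :\: A| -
    \sum_(u in U :\: A) x u * (rise t y #|A| * rise t (Y + t) #|U :\: A|.-1))).
  rewrite -(pair_big_dep (fun A : {set V} => A \subset U)
     (fun A h => forest (S' A) (U :\: A) h)
     (fun A h => \prod_u rise t (x u) #|fiber U (glue (A, h)) u|)) /=.
  apply: eq_bigr => A AU.
  transitivity (rise t y #|A| * \sum_(h | forest (S' A) (U :\: A) h)
      \prod_u rise t (x u) #|fiber (U :\: A) h u|); last first.
    rewrite IH; first last.
    - rewrite disjoints_subset; apply/subsetP=> w; rewrite !inE negb_and negbK.
      by case: (w \in A) => //=; rewrite orbF => /andP[_ wS]; rewrite (disjointFr dSU).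
    - by rewrite SU' //; move: ltm; rewrite (cardsD1 s (S :|: U)) inE sS.
    by rewrite SU' // mulrBr mulrCA mulr_suml.
  rewrite mulr_sumr; apply: eq_bigr => h hF.
  have Qh : Q (A, h) by rewrite /Q AU.
  have [_ [fibA _]] := glueP _ Qh.
  rewrite (bigD1 s) //= [in RHS](bigD1 s) //= fibA.
  have -> : fiber (U :\: A) h s = set0.
    apply/setP=> v; rewrite !inE; apply/negP=> /andP[/andP[vA vU] /eqP hv].
    case/forestP: hF => /(_ v); rewrite SU' // !inE vA vU hv eqxx => /(_ isT) //.
  rewrite cards0 rise0 mul1r; congr (_ * _); apply: eq_bigr => u us.
  congr (rise _ _ #|pred_of_set _|); apply/setP=> v; rewrite !inE ffunE /=.
  by case: (v \in A) => //=; rewrite eq_sym (negPf us) andbF.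
rewrite sumrB rise_subsets; congr (_ - _).
(* For fixed [u] the set [A] now runs over the subsets of [U :\ u], and Chu-Vandermonde applies to
   [y] and [Y + t]. *)
rewrite (exchange_big_dep (fun u => u \in U)) /=; last first.
  by move=> A u _; rewrite inE => /andP[].
rewrite mulr_suml; apply: eq_bigr => u uU; rewrite -mulr_sumr; congr (_ * _).
have cU : #|U|.-1 = #|U :\ u| by rewrite (cardsD1 u U) uU.
rewrite cU -addrA -rise_subsets; apply: eq_big => [A|A].
  by rewrite subsetD1 inE uU andbT.
case/andP=> AU; rewrite inE => /andP[uA _].
by congr (_ * rise _ _ _); rewrite (cardsD1 u) inE uA uU /= setDDl setDDl setUC.
Qed.

(** * Orderings of brothers, weighted by their overtaken vertices *)

Definition placed (V : finType) (N : nat) (C : {set V}) (p : V -> V)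
    (q : {ffun V -> 'I_N.+1}) : bool :=
  [forall v, if v \in C then
      (q v < #|fiber C p (p v)|)%N &&
      [forall w in fiber C p (p v), (q w == q v) ==> (w == v)]
    else q v == ord0].

Lemma placedP (V : finType) (N : nat) (C : {set V}) (p : V -> V)
    (q : {ffun V -> 'I_N.+1}) :
  reflect [/\ forall v, v \in C -> (q v < #|fiber C p (p v)|)%N,
              forall v w, v \in C -> w \in C -> p v = p w -> q v = q w -> v = w &
              forall v, v \notin C -> q v = ord0]
          (placed C p q).
Proof.
apply: (iffP forallP) => [h|[h1 h2 h3] v].
  split=> [v vC|v w vC wC pvw qvw|v /negPf vC]; have := h v; rewrite vC.
  - by case/andP.
  - case/andP=> _ /forall_inP /(_ w); rewrite inE wC pvw qvw !eqxx => /(_ isT).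
    by move/eqP.
  - by move/eqP.
case: ifPn => [vC|/h3 -> //]; rewrite h1 //=; apply/forall_inP=> w.
rewrite inE => /andP[wC /eqP pw]; apply/implyP=> /eqP qw.
by rewrite (h2 w v).
Qed.

(* With [b] the smallest descendant, these are the elder vertices. *)
Definition overtaken (V : finType) (N : nat) (C : {set V}) (p : V -> V)
    (b : V -> nat) (q : {ffun V -> 'I_N.+1}) (v : V) : bool :=
  [exists k in fiber C p (p v), (q v < q k)%N && (b k < b v)%N].

(* Inserting a vertex [v] with the largest key among its brothers: its position
   is arbitrary, it is overtaken unless it comes last, and it does not change
   which of its brothers are overtaken. Brothers to the right of the insertion
   point shift by one, hence [bump] and [unbump]. *)
Lemma sum_placed (R : comPzRingType) (t : R) (V : finType) (N : nat)
    (C : {set V}) (p : V -> V) (b : V -> nat) (x : V -> R) :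
  (#|C| <= N.+1)%N ->
  (forall v w, v \in C -> w \in C -> p v = p w -> b v = b w -> v = w) ->
  \sum_(q : {ffun V -> 'I_N.+1} | placed C p q)
     \prod_(v in C) (if overtaken C p b q v then t else x (p v)) =
  \prod_u rise t (x u) #|fiber C p u|.
Proof.
elim: {C}_.+1 {-2}C (ltnSn #|C|) => // m IH C ltm leN binj.
have [C0|[v0 v0C]] := set_0Vmem C.
  rewrite C0 (big_pred1 [ffun=> ord0]) => [|q /=]; last first.
    apply/placedP/eqP => [[_ _ q0]|->].
      by apply/ffunP=> w; rewrite ffunE q0 ?inE.
    by split=> [v|v w|v]; rewrite ?inE ?ffunE.
  rewrite big_set0 big1 // => u _.
  by rewrite (_ : fiber _ _ _ = set0) ?cards0 ?rise0 //; apply/setP=> w; rewrite !inE.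
have [v vC vmax] : exists2 v, v \in C & forall w, w \in C -> (b w <= b v)%N.
  by case: (arg_maxnP b v0C) => v; exists v.
pose C' := C :\ v.
have cC : #|C| = #|C'|.+1 by rewrite (cardsD1 v) vC.
have C'C w : w \in C' -> w \in C by rewrite inE => /andP[].
have CC' w : w \in C -> w != v -> w \in C' by move=> wC wv; rewrite !inE wv.
pose d := #|fiber C' p (p v)|.
have fibv : #|fiber C p (p v)| = d.+1.
  rewrite (cardsD1 v) inE vC eqxx; congr _.+1.
  by apply: eq_card => w; rewrite !inE andbA.
have fibD u : u != p v -> fiber C p u = fiber C' p u.
  move=> uv; apply/setP=> w; rewrite !inE; have [->|//] := eqVneq w v.
  by rewrite [p v == u]eq_sym (negPf uv) andbF.
(* Positions after an insertion are at most [d], so this bound makes [inord] faithful in [ins]. *)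
have dN : (d < N.+1)%N.
  apply: leq_trans leN; rewrite cC ltnS; apply: subset_leq_card.
  by apply/subsetP=> w; rewrite inE => /andP[].
pose ins (a : {ffun V -> 'I_N.+1} * 'I_N.+1) : {ffun V -> 'I_N.+1} :=
  [ffun w => if w == v then a.2 else
     if w \in fiber C p (p v) then inord (bump a.2 (a.1 w)) else a.1 w].
(* The vertex [v] leaves the domain, so it receives the default [ord0] that [placed C'] demands
   outside [C']. *)
pose del (q : {ffun V -> 'I_N.+1}) : {ffun V -> 'I_N.+1} * 'I_N.+1 :=
  ([ffun w => if w == v then ord0 else
     if w \in fiber C p (p v) then inord (unbump (q v) (q w)) else q w], q v).
pose Q (a : {ffun V -> 'I_N.+1} * 'I_N.+1) := placed C' p a.1 && (a.2 < d.+1)%N.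
have insv a : ins a v = a.2 by rewrite ffunE eqxx.
have insE a w : Q a -> w \in C' -> p w = p v -> ins a w = bump a.2 (a.1 w) :> nat.
  case/andP=> /placedP[qlt _ _] ad wC' pw; rewrite ffunE inE C'C // pw eqxx.
  have := wC'; rewrite !inE => /andP[/negPf -> _]; rewrite inordK //.
  have := qlt w wC'; rewrite pw -/d /bump => ?; lia.
have insD a w : w != v -> p w != p v -> ins a w = a.1 w.
  by move=> /negPf wv /negPf pw; rewrite ffunE wv inE pw andbF.
have delE q w : placed C p q -> w \in C' -> p w = p v ->
    (q w != q v :> nat) * ((del q).1 w = unbump (q v) (q w) :> nat).
  case/placedP=> qlt qinj _ wC' pw; have wv : w != v by move: wC'; rewrite !inE => /andP[].
  split; first by apply: contra wv => /eqP/val_inj qwv; apply/eqP/qinj => //; exact: C'C.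
  rewrite ffunE inE C'C // pw eqxx (negPf wv) /= inordK //.
  by rewrite /unbump; apply: leq_ltn_trans (leq_subr _ _) (ltn_ord _).
have insP a : Q a -> placed C p (ins a) /\ del (ins a) = a.
  move=> Qa; have /andP[/placedP[qlt qinj q0] ad] := Qa.
  split.
    apply/placedP; split=> [w wC|w z wC zC pwz|w wC].
    - have [->|wv] := eqVneq w v; first by rewrite insv fibv.
      have wC' := CC' _ wC wv; have := qlt w wC'.
      have [pw|pw] := eqVneq (p w) (p v); last by rewrite insD // fibD.
      by rewrite insE // pw fibv -/d /bump; lia.
    - have [pw|pw] := eqVneq (p w) (p v); last first.
        have pz : p z != p v by rewrite -pwz.
        have wv : w != v by apply: contraNneq pw => ->.
        have zv : z != v by apply: contraNneq pz => ->.
        by rewrite !insD //; apply: qinj; rewrite ?CC'.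
      have pz : p z = p v by rewrite -pwz.
      move/(congr1 val) => /=.
      have [->|wv] := eqVneq w v; have [->|zv] := eqVneq z v => //.
      + by rewrite insv insE ?CC' // => /eqP; rewrite (negPf (neq_bump _ _)).
      + by rewrite insv insE ?CC' // => /eqP; rewrite eq_sym (negPf (neq_bump _ _)).
      rewrite !insE ?CC' // => /(can_inj (@bumpK _)) /val_inj.
      by apply: qinj; rewrite ?CC'.
    have wv : w != v by apply: contraNneq wC => ->.
    by rewrite ffunE (negPf wv) inE (negPf wC) /= q0 // inE (negPf wC) andbF.
  case: a Qa ad qlt qinj q0 => q' j Qa /= jd qlt qinj q0.
  rewrite /del insv /=; congr (_, _); apply/ffunP=> w; rewrite ffunE.
  case: eqVneq => [->|wv]; first by rewrite q0 // !inE eqxx.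
  case: ifPn => [|wfib]; last by rewrite ffunE (negPf wv) (negPf wfib).
  rewrite inE => /andP[wC /eqP pw]; apply: val_inj.
  by rewrite insE ?CC' //= bumpK inord_val.
have delP q : placed C p q -> Q (del q) /\ ins (del q) = q.
  move=> Pq; have /placedP[qlt qinj q0] := Pq.
  have qvd : (q v < d.+1)%N by rewrite -fibv qlt.
  have Qd : Q (del q).
    rewrite /Q qvd andbT; apply/placedP; split=> [w wC'|w z wC' zC' pwz|w wC'].
    - have := qlt w (C'C _ wC').
      have [pw|pw] := eqVneq (p w) (p v).
        have [qwv ->] := delE q w Pq wC' pw; rewrite pw fibv -/d /unbump; lia.
      rewrite ffunE inE (negPf pw) andbF fibD //.
      by move: wC'; rewrite !inE => /andP[/negPf ->].
    - have [pw|pw] := eqVneq (p w) (p v).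
        have pz : p z = p v by rewrite -pwz.
        have [qwv dw] := delE q w Pq wC' pw; have [qzv dz] := delE q z Pq zC' pz.
        move/(congr1 val); rewrite /= dw dz => e.
        by apply: qinj; rewrite ?C'C //; apply: val_inj => /=; move: e; rewrite /unbump; lia.
      rewrite !ffunE !inE -pwz (negPf pw) !andbF.
      move: (wC') (zC'); rewrite !inE => /andP[/negPf -> wC] /andP[/negPf -> zC].
      exact: qinj.
    rewrite ffunE; move: wC'; rewrite !inE negb_and negbK.
    by case: eqVneq => //= _ wC; rewrite (negPf wC) /= q0.
  split=> //; apply/ffunP=> w; apply: val_inj => /=.
  have [->|wv] := eqVneq w v; first by rewrite insv.
  have [wC|wC] := boolP (w \in C); last first.
    by rewrite ffunE (negPf wv) inE (negPf wC) ffunE (negPf wv) inE (negPf wC).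
  have [pw|pw] := eqVneq (p w) (p v).
    rewrite insE ?CC' //; have [qwv ->] := delE q w Pq (CC' _ wC wv) pw.
    by rewrite unbumpK.
  by rewrite insD // ffunE (negPf wv) inE (negPf pw) andbF.
rewrite (@big_bij _ _ _ _ _ (placed C p) Q del ins _ delP insP) /=.
have blt k : k \in C' -> p k = p v -> (b k < b v)%N.
  move=> kC' pk; rewrite ltn_neqAle vmax ?C'C // andbT.
  move: (kC'); rewrite !inE => /andP[kv kC].
  by apply: contra kv => /eqP bk; apply/eqP/binj.
have ovv a : Q a -> overtaken C p b (ins a) v = (a.2 < d)%N.
  move=> Qa; have /andP[/placedP[qlt qinj q0] ad] := Qa.
  apply/exists_inP/idP => [[k]|jd].
    rewrite inE => /andP[kC /eqP pk]; rewrite insv.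
    have [->|kv] := eqVneq k v; first by rewrite ltnn andbF.
    have kC' := CC' _ kC kv; rewrite insE // => /andP[lt _].
    by have := qlt k kC'; rewrite pk -/d; move: lt; rewrite /bump; lia.
  (* Pigeonhole: otherwise the [d] brothers of [v] would have distinct positions all below [a.2],
     which is less than [d]. *)
  have [k kfib kj] : exists2 k, k \in fiber C' p (p v) & (a.2 <= a.1 k)%N.
    apply/exists_inP; apply: contraLR jd; rewrite negb_exists_in -leqNgt.
    move/forall_inP=> small.
    have inj : {in fiber C' p (p v) &, injective a.1}.
      move=> w z; rewrite !inE => /andP[wC /eqP pw] /andP[zC /eqP pz].
      by apply: qinj; rewrite ?inE ?wC ?zC // pw pz.
    rewrite /d -(card_in_imset inj).
    have -> : nat_of_ord a.2 = #|[set i : 'I_N.+1 | (i < a.2)%N]|.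
      rewrite -sum1_card (eq_bigl (fun i : 'I_N.+1 => (i < a.2)%N)).
        by rewrite -(big_ord_widen N.+1 (fun=> 1%N)) ?sum1_card ?card_ord // ltnW.
      by move=> i; rewrite inE.
    apply: subset_leq_card; apply/subsetP=> i /imsetP[w wf ->].
    by rewrite inE ltnNge small.
  move: kfib; rewrite inE => /andP[kC' /eqP pk].
  exists k; first by rewrite inE C'C //= pk.
  by rewrite insv insE // blt // andbT /bump kj.
(* [bump] preserves the order of the old positions, and [v], having the largest key, overtakes
   nobody. *)
have ovE a w : Q a -> w \in C' ->
    overtaken C p b (ins a) w = overtaken C' p b a.1 w.
  move=> Qa wC'.
  have [pw|pw] := eqVneq (p w) (p v).
    have ltE k : k \in C' -> p k = p v -> (ins a w < ins a k)%N = (a.1 w < a.1 k)%N.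
      by move=> kC' pk; rewrite !insE // /bump; lia.
    apply/exists_inP/exists_inP => -[k]; rewrite inE pw => /andP[kC /eqP pk].
      have [->|kv] := eqVneq k v.
        by rewrite [(b v < _)%N]ltnNge vmax ?C'C // andbF.
      rewrite ltE ?CC' // => hk; exists k; rewrite // inE CC' //=; exact/eqP.
    by rewrite -ltE // => hk; exists k; rewrite // inE C'C //=; exact/eqP.
  have nv k : p k = p w -> k != v by move=> pk; apply: contraNneq pw => <-; rewrite pk.
  have wv := nv w erefl.
  rewrite /overtaken fibD //; apply: eq_existsb => k.
  case kf: (k \in _) => //=; move: kf; rewrite inE => /andP[kC' /eqP pk].
  by rewrite !insD ?nv // pk.
transitivity (\sum_(a | Q a)
   (\prod_(w in C') (if overtaken C' p b a.1 w then t else x (p w))) *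
   (if (a.2 < d)%N then t else x (p v))).
  apply: eq_bigr => a Qa; rewrite (big_setD1 v) //= ovv // mulrC; congr (_ * _).
  by apply: eq_bigr => w wC'; rewrite ovE.
rewrite -(pair_big (placed C' p) (fun j : 'I_N.+1 => (j < d.+1)%N)
  (fun q j => (\prod_(w in C') (if overtaken C' p b q w then t else x (p w))) *
   (if (j < d)%N then t else x (p v)))) /=.
rewrite -big_distrlr /= IH; first last.
- by move=> w z wC' zC'; apply: binj; apply: C'C.
- by apply: leq_trans leN; rewrite cC.
- by rewrite cC in ltm.
(* The [d] positions before the last weigh [t] and the last weighs [x (p v)]: together the factor
   that takes [rise] from length [d] to [d.+1]. *)
have -> : \sum_(j < N.+1 | (j < d.+1)%N) (if (j < d)%N then t else x (p v)) =
    x (p v) + d%:R * t.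
  rewrite -(big_ord_widen _ (fun j => if (j < d)%N then t else x (p v))) //.
  rewrite big_ord_recr /= ltnn addrC (eq_bigr (fun=> t)) => [|i _]; last by rewrite ltn_ord.
  by rewrite sumr_const card_ord mulr_natl.
rewrite (bigD1 (p v)) //= [in RHS](bigD1 (p v)) //= fibv riseS mulrAC.
by congr (_ * _); apply: eq_bigr => u uv; rewrite fibD.
Qed.

(** * From encoded plane trees to forests with ordered brothers *)

Lemma iter_forest (n : nat) (r : 'I_n) (f : {ffun 'I_n -> 'I_n}) :
  (f r == r) && [forall v, iter n f v == r] = forest [set r] [set~ r] f.
Proof.
apply/andP/forestP => [[/eqP fr /forallP fn]|[_ fr fW]].
  split=> [v _|v|W Wr Wf]; first by rewrite setUCr inE.
    by rewrite !inE negbK => /eqP ->.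
  (* A nonempty stable [W] would contain the [n]-th iterate of one of its points, which is [r]. *)
  have [//|[w wW]] := set_0Vmem W.
  have Wi k : iter k f w \in W by elim: k => //= k; apply: Wf.
  by have := subsetP Wr _ (Wi n); rewrite (eqP (fn w)) !inE eqxx.
have frr : f r = r by rewrite fr // !inE eqxx.
split; first by rewrite frr.
apply/forallP=> v; have [rv|rv] := boolP (fconnect f v r).
  have len : (findex f v r <= n)%N.
    by rewrite ltnW // (leq_trans (findex_max rv)) // -[leqRHS]card_ord max_card.
  rewrite -[X in iter X](subnK len) iterD iter_findex //.
  by elim: (n - _)%N => //= k /eqP ->; apply/eqP.
(* An orbit missing [r] would be a nonempty stable set of non-roots. *)
have : [set w | fconnect f v w] = set0.
  apply: fW => [|w]; last first.
    by rewrite !inE => vw; apply: connect_trans vw (fconnect1 f w).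
  by apply/subsetP=> w; rewrite !inE; apply: contraTneq => ->.
by move/setP/(_ v); rewrite !inE connect0.
Qed.

(** Equal minima give [v] and [w] a common descendant, so one of them is an ancestor of the other;
    for brothers other than the root this would create a cycle. *)
Lemma beta_sibling_inj (n : nat) (r : 'I_n) (T : ptree n) (v w : 'I_n) :
  tpar T r = r -> (forall u, iter n (tpar T) u = r) ->
  v != r -> w != r -> tpar T v = tpar T w -> beta T v = beta T w -> v = w.
Proof.
set p := tpar T => pr pn.
have attained u : exists2 j : 'I_n, beta T u = j & exists k, iter k p j = u.
  have uu : desc T u u by apply/existsP; exists ord0.
  (* The default [n] of the minimum never survives: [u] is its own descendant, so [beta T u] is at
     most [u], which is below [n]. *)
  suff [|[j Tj ->]] : beta T u = n \/ exists2 j : 'I_n, desc T u j & beta T u = j.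
  - move=> bn; suff: (beta T u <= u)%N by rewrite bn leqNgt ltn_ord.
    rewrite /beta; elim: (index_enum _) (mem_index_enum u) => // i e IHe.
    rewrite inE big_cons => /predU1P[<-|/IHe le]; first by rewrite uu geq_minl.
    by case: ifP => // _; rewrite geq_min le orbT.
  - by exists j => //; case/existsP: Tj => k /eqP; exists k.
  rewrite /beta; apply: (big_ind (fun m => m = n \/ exists2 j : 'I_n, desc T u j & m = j)).
  - by left.
  - by move=> a c ? ?; rewrite /minn; case: ifP.
  by move=> j Tj; right; exists j.
(* A periodic [u] returns to itself after [n * k.+1] steps, but any [n] or more steps end at [r]. *)
have acyclic u k : u != r -> iter k.+1 p u != u.
  apply: contraNneq => pu; apply/eqP.
  have per m : iter (m * k.+1) p u = u.
    by elim: m => // m; rewrite mulSn iterD => ->.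
  rewrite -(per n) mulnS addnC iterD pn.
  by elim: (n * k)%N => //= m ->.
move=> vr wr pvw bvw.
have [j ej [k kv]] := attained v; have [j' ej' [l lw]] := attained w.
have jj : j = j' by apply: val_inj; rewrite /= -ej -ej'.
move: {ej ej' bvw} jj lw => <- lw.
have main a c (y z : 'I_n) : z != r -> p y = p z -> iter a p j = y ->
    iter (c + a) p j = z -> y = z.
  move=> zr pyz ay; rewrite iterD ay; case: c => // c.
  by rewrite iterSr pyz -iterSr => /eqP; rewrite (negPf (acyclic _ _ zr)).
have [kl|/ltnW lk] := leqP k l.
  by apply: (main k (l - k)%N); rewrite ?subnK.
by apply/esym/(main l (k - l)%N); rewrite ?subnK.
Qed.

(** Position 0 of the root turns into the default value of [placed] outside [[set~ r]]. *)
Lemma is_plane_treeE (N : nat) (r : 'I_N.+1) (p q : {ffun 'I_N.+1 -> 'I_N.+1}) :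
  is_plane_tree r (p, q) =
  forest [set r] [set~ r] p && placed [set~ r] p q.
Proof.
rewrite -iter_forest /is_plane_tree /tpar /tpos /deg /=.
have chE u : children r (p, q) u = fiber [set~ r] p u.
  by apply/setP=> v; rewrite !inE.
rewrite -andbA; congr (_ && _); rewrite andbCA; congr (_ && _).
apply/andP/placedP => [[/eqP qr /forallP h]|[h1 h2 h3]].
  split=> [v|v w|v].
  - rewrite !inE => vr; have /andP[/forall_inP /(_ v) + _] := h (p v).
    by rewrite chE !inE vr eqxx => /(_ isT).
  - rewrite !inE => vr wr pvw qvw; have /andP[_ /forall_inP /(_ v)] := h (p v).
    rewrite chE !inE vr eqxx => /(_ isT)/forall_inP/(_ w).
    by rewrite !inE wr pvw qvw !eqxx => /(_ isT)/eqP.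
  by rewrite !inE negbK => /eqP ->; apply: val_inj.
split; first by rewrite h3 // !inE eqxx.
apply/forallP=> u; rewrite chE; apply/andP; split; apply/forall_inP=> v.
  by rewrite inE => /andP[vr /eqP <-]; apply: h1.
rewrite inE => /andP[vr /eqP pv]; apply/forall_inP=> w.
rewrite inE => /andP[wr /eqP pw]; apply/implyP=> /eqP/val_inj qvw.
by apply/eqP/h2; rewrite ?pv.
Qed.

(** Elder vertices give the power of [t]; grouping the others by parent gives the powers of [x]. As
    [beta] depends on parents only, [beta (p, p)], with an arbitrary second component, is a key
    independent of [q], as [sum_placed] requires. *)
Lemma plane_tree_weight (R : comPzRingType) (t : R) (N : nat) (r : 'I_N.+1)
    (x : 'I_N.+1 -> R) (p q : {ffun 'I_N.+1 -> 'I_N.+1}) :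
  t ^+ eld r (p, q) * \prod_i x i ^+ young r (p, q) i =
  \prod_(v in [set~ r])
    (if overtaken [set~ r] p (beta (p, p)) q v then t else x (p v)).
Proof.
set T := (p, q).
have chE u : children r T u = fiber [set~ r] p u.
  by apply/setP=> v; rewrite !inE.
have elE v : v != r -> elder r T v = overtaken [set~ r] p (beta (p, p)) q v.
  by move=> vr; rewrite /elder vr chE.
rewrite [RHS](bigID (elder r T)) /=; congr (_ * _).
  rewrite /eld -prodr_const; apply: eq_big => v.
    by rewrite !inE /elder; case: eqP.
  by rewrite inE => ev; rewrite -elE ?ev //; case/andP: ev.
rewrite [RHS](partition_big p predT) //=; apply: eq_bigr => u _.
rewrite /young /deg /eldv.
have -> : (#|children r T u| - #|[set j in children r T u | elder r T j]| =
    #|[set j in children r T u | ~~ elder r T j]|)%N.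
  rewrite -(cardsID [set j | elder r T j] (children r T u)).
  rewrite -[X in (X + _ - _)%N](_ : #|[set j in children r T u | elder r T j]| = _).
    by rewrite addKn; apply: eq_card => j; rewrite !inE andbC.
  by apply: eq_card => j; rewrite !inE.
rewrite -prodr_const; apply: eq_big => v.
  by rewrite !inE -!andbA; congr (_ && _); rewrite andbC.
by rewrite !inE => /andP[/andP[vr /eqP pv] ev]; rewrite -elE // (negPf ev) -pv.
Qed.

Theorem theorem4p6 (R : comNzRingType) (n : nat) (r : 'I_n)
    (x : 'I_n -> R) (t : R) :
  (2 <= n)%N ->
  \sum_(T : ptree n | is_plane_tree r T)
      t ^+ eld r T * \prod_(i < n) x i ^+ young r T i
  = x r * \prod_(1 <= k < n.-1) (\sum_(i < n) x i + k%:R * t).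
Proof.
case: n r x => [|[|N]] // r x _.
transitivity (\sum_(p | forest [set r] [set~ r] p)
    \prod_u rise t (x u) #|fiber [set~ r] p u|).
  transitivity (\sum_(T : ptree N.+2 | forest [set r] [set~ r] T.1 && placed [set~ r] T.1 T.2)
    \prod_(v in [set~ r])
      (if overtaken [set~ r] T.1 (beta (T.1, T.1)) T.2 v then t else x (T.1 v))).
    apply: eq_big => [[p q]|[p q] _]; first exact: is_plane_treeE.
    exact: plane_tree_weight.
  (* For a fixed parent function [p], the sum over [q] is given by [sum_placed] with smallest
     descendants as keys. *)
  rewrite -(pair_big_dep (fun p => forest [set r] [set~ r] p)
    (fun p (q : {ffun 'I_N.+2 -> 'I_N.+2}) => placed [set~ r] p q)
    (fun p (q : {ffun 'I_N.+2 -> 'I_N.+2}) => \prod_(v in [set~ r])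
      (if overtaken [set~ r] p (beta (p, p)) q v then t else x (p v)))) /=.
  apply: eq_bigr => p; rewrite -iter_forest => /andP[/eqP pr /forallP pn].
  apply: sum_placed => [|v w]; first by rewrite -[leqRHS]card_ord max_card.
  rewrite !inE; apply: (@beta_sibling_inj _ r (p, p)) => // u; exact/eqP/pn.
rewrite sum_forest; last by rewrite -setI_eq0 setICr.
have -> : \sum_(u in [set r] :|: [set~ r]) x u = \sum_i x i.
  by apply: eq_bigl => i; rewrite setUCr inE.
have -> : \sum_(u in [set~ r]) x u = \sum_(i | i != r) x i.
  by apply: eq_bigl => i; rewrite !inE.
(* Both terms share a [rise] of length [N]; the total of [x] minus the sum over the non-roots leaves
   [x r]. *)
rewrite cardsC1 card_ord /= riseSl -mulrBl.
rewrite {1}(bigD1 r) //= addrK; congr (_ * _).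
(* The extra [t] in the argument of [rise] shifts its indices from 0 to 1. *)
rewrite big_add1 /= big_mkord; apply: eq_bigr => i _.
by rewrite -natr1 mulrDl mul1r addrAC addrA.
Qed.
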